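(* Suppose that the $Y$-harmonic system of an edge-complete graph $G$ has a solution $(\beta,\alpha_j)$, $\boldsymbol c_j$, $j\in V_G$. Then $$h_G=\sum_{j\in V_G}\boldsymbol c_j\,[(\beta,\alpha_j),\cdot]$$ is a harmonic function of $Y$ (on $\Omega_Y$).
   Context: Let $d\ge 2$, $\mathcal N_0=\{0,1,\dots,d\}$, $\mathcal N_+=\{1,\dots,d\}$, $\mathcal N=\{2,\dots,d\}$; $e_1,\dots,e_d$ are the unit vectors of $\mathbb{Z}^d$, $e_0=0$. Let $p=(p(j,k))_{j,k\in\mathcal N_0}$ be a nonnegative matrix with zero diagonal and entries summing to $1$, irreducible (the directed graph with edges $j\to k$ whenever $p(j,k)>0$ is strongly connected). Put $\mu_j=\sum_{k\in\mathcal N_0}p(j,k)$. Stability is assumed: if $\nu$ is the unique solution of $\nu_j=p(0,j)+\sum_{k\in\mathcal N_+}\nu_kp(k,j)/\mu_k$, $j\in\mathcal N_+$, then $\nu_j<\mu_j$ for all $j\in\mathcal N_+$. Let $\mathcal I$ be the map on $\mathbb{Z}^d$ reversing the sign of the first coordinate, $\mathcal V=\{\mathcal I(e_k-e_j):p(j,k)>0\}$, and $p(v)=p(j,k)$ for $v=\mathcal I(e_k-e_j)$. $Y$ is the Markov chain on $\Omega_Y=\mathbb{Z}\times\mathbb{Z}_+^{d-1}$ with i.i.d. increments of law $(p(v))_{v\in\mathcal V}$, where an increment is replaced by $0$ whenever it would take $Y$ out of $\Omega_Y$. A function $V$ is a harmonic function of $Y$ on $O\subset\Omega_Y$ if $V(y)=\mathbb{E}_y[V(Y_1)]$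 for all $y\in O$. For $\beta\in\mathbb{C}\setminus\{0\}$, $\alpha=(\alpha(2),\dots,\alpha(d))\in(\mathbb{C}\setminus\{0\})^{\mathcal N}$ and $z\in\mathbb{Z}^d$, $[(\beta,\alpha),z]=\beta^{z(1)-\sum_{j\in\mathcal N}z(j)}\prod_{j\in\mathcal N}\alpha(j)^{z(j)}$. $\mathcal H$ is the set of such $(\beta,\alpha)$ with $\sum_{v\in\mathcal V}p(v)[(\beta,\alpha),v]=1$; for $l\in\mathcal N$, $\mathcal H_l$ is the set of such $(\beta,\alpha)$ with $\mu_l+\sum_{v\in\mathcal V,\,v(l)\ne-1}p(v)[(\beta,\alpha),v]=1$. $C(l,\beta,\alpha)=\mu_l-\sum_{v\in\mathcal V,\,v(l)=-1}p(v)[(\beta,\alpha),v]$. $\alpha\{l\}$ is $\alpha$ with its $l$-th entry replaced by $1$. Two distinct points $(\beta,\alpha_1),(\beta,\alpha_2)\in\mathcal H$ are $l$-conjugate if $\alpha_1,\alpha_2$ agree on $\mathcal N\setminus\{l\}$ and $\alpha_2(l)=\frac1{\alpha_1(l)}\frac{\sum_{v(l)=-1}p(v)[(\beta,\alpha_1\{l\}),v]}{\sum_{v(l)=1}p(v)[(\beta,\alpha_1\{l\}),v]}$ (with nonzero denominator). A labeled graph $G$ has a finite vertex set $V_G$ and is symmetric: for $i\ne j$, $G(i,j)=G(j,i)$ is $0$ if $i,j$ are not connected and is $l\in\mathcal N$ if they are connected by an edge with label $l$; $G(j,j)\subset\mathcal N$ is the set of labels of the loops at $j$. $G$ is edge-complete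 (with respect to $\mathcal N$) if for each vertex $j$ and each $l\in\mathcal N$ there is exactly one edge with label $l$ at $j$ (possibly a loop). The $Y$-harmonic system of an edge-complete $G$ has unknowns $\beta\in\mathbb{C}$, $\alpha_j\in\mathbb{C}^{\mathcal N}$, $\boldsymbol c_j\in\mathbb{C}$, $j\in V_G$, and constraints: (1) $(\beta,\alpha_j)\in\mathcal H$ and $\boldsymbol c_j\ne0$ for all $j$; (2) $\alpha_i\ne\alpha_j$ for $i\ne j$; (3) if $i\ne j$ and $G(i,j)\ne0$, then $(\beta,\alpha_i),(\beta,\alpha_j)$ are $G(i,j)$-conjugate; (4) if $i\ne j$ and $G(i,j)\ne0$, then $\boldsymbol c_i/\boldsymbol c_j=-C(G(i,j),\beta,\alpha_j)/C(G(i,j),\beta,\alpha_i)$; (5) $(\beta,\alpha_j)\in\mathcal H_l$ for all $l\in G(j,j)$ and all $j$. *)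

(* Defs.v *)
From HB Require Import structures.
From mathcomp Require Import all_boot all_order all_algebra.
From mathcomp Require Import reals complex.

Set Implicit Arguments.
Unset Strict Implicit.
Unset Printing Implicit Defensive.

Import Order.TTheory GRing.Theory Num.Theory.

Local Open Scope ring_scope.
Local Open Scope complex_scope.

(* The dimension is d = n.+1, and the three index sets are the ordinal types
     N_0 = {0, ..., d} ~ 'I_n.+2,
     N_+ = {1, ..., d} ~ 'I_n.+1   (i : 'I_n.+1 stands for i + 1),
     N   = {2, ..., d} ~ 'I_n      (l : 'I_n stands for l + 2),
   related by the inclusions nplus and label below.  Z^d is 'rV[int]_n.+1,
   so that the first coordinate z(1) is z ord0 ord0.                        *)

Definition nplus n (i : 'I_n.+1) : 'I_n.+2 := lift ord0 i.

Definition label n (l : 'I_n) : 'I_n.+1 := lift ord0 l.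

Definition coord1 n (z : 'rV[int]_n.+1) : int := z ord0 ord0.

Definition coord n (z : 'rV[int]_n.+1) (l : 'I_n) : int := z ord0 (label l).

Section Network.
Variables (R : realType) (n : nat).
Implicit Types (p : 'M[R]_n.+2) (v y z : 'rV[int]_n.+1) (l : 'I_n).

Definition routing_matrix p : Prop :=
  [/\ forall j k, 0 <= p j k, forall j, p j j = 0 & \sum_j \sum_k p j k = 1].

Definition irreducible_matrix p : Prop :=
  forall j k, connect [rel a b | 0 < p a b] j k.

Definition mu p (j : 'I_n.+2) : R := \sum_k p j k.

Definition traffic_equations p (nu : 'I_n.+1 -> R) : Prop :=
  forall j, nu j = p ord0 (nplus j)
                   + \sum_k nu k * p (nplus k) (nplus j) / mu p (nplus k).

Definition stable p : Prop :=
  forall nu, traffic_equations p nu -> forall j, nu j < mu p (nplus j).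

(* In particular unitv ord0 = 0. *)
Definition unitv (k : 'I_n.+2) : 'rV[int]_n.+1 :=
  \row_i (nplus i == k)%:R.

Definition flip z : 'rV[int]_n.+1 :=
  \row_i (if i == ord0 then - z ord0 i else z ord0 i).

Definition increment (j k : 'I_n.+2) : 'rV[int]_n.+1 :=
  flip (unitv k - unitv j).

Definition jumps p : seq 'rV[int]_n.+1 :=
  undup [seq increment jk.1 jk.2
        | jk <- enum {: 'I_n.+2 * 'I_n.+2} & 0 < p jk.1 jk.2].

(* For v = increment j k with j != k the sum has the single term p j k, see
   jump_prob_increment. *)
Definition jump_prob p v : R :=
  \sum_(jk : 'I_n.+2 * 'I_n.+2 | increment jk.1 jk.2 == v) p jk.1 jk.2.

Lemma increment_inj j k j' k' :
  j != k -> increment j' k' = increment j k -> (j' = j) * (k' = k).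
Proof.
move=> jk /rowP E.
have {}E i : (nplus i == k')%:R - (nplus i == j')%:R
    = (nplus i == k)%:R - (nplus i == j)%:R :> int.
  move/(_ i): E; rewrite !mxE; case: ifP => _ //.
  by move/oppr_inj.
have {}E (a : 'I_n.+2) : (a == k')%:R - (a == j')%:R
    = (a == k)%:R - (a == j)%:R :> int.
  have S (b : 'I_n.+2) : \sum_(a : 'I_n.+2) (a == b)%:R = 1 :> int.
    rewrite (bigD1 b) //= eqxx big1 ?addr0 // => c /negPf ->; by [].
  have E1 b c : \sum_(a : 'I_n.+2) ((a == b)%:R - (a == c)%:R) = 0 :> int.
    by rewrite sumrB !S subrr.
  have := etrans (E1 k' j') (esym (E1 k j)).
  rewrite big_ord_recl [in RHS]big_ord_recl.
  under [in LHS]eq_bigr => i _ do rewrite (E i).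
  move=> /addIr E0.
  by case: (unliftP ord0 a) => [i|] -> //; exact: E.
split; apply/eqP.
  move: (E j); rewrite eqxx (negPf jk) [j' == j]eq_sym.
  by case: (j == k'); case: (j == j').
move: (E k); rewrite eqxx [k == j]eq_sym (negPf jk) [k' == k]eq_sym.
by case: (k == k'); case: (k == j').
Qed.

Lemma jump_prob_increment p j k :
  j != k -> jump_prob p (increment j k) = p j k.
Proof.
move=> jk; rewrite /jump_prob (bigD1 (j, k)) //= big1 ?addr0 // => -[a b] /=.
by case/andP=> /eqP /(increment_inj jk) [-> ->]; rewrite eqxx.
Qed.

(* The state space Z x Z_+^(d-1). *)
Definition OmegaY : pred 'rV[int]_n.+1 :=
  [pred y | [forall l, 0 <= coord y l]].

Definition stepY y v : 'rV[int]_n.+1 :=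
  if y + v \in OmegaY then y + v else y.

(* E_y [V (Y_1)]; the increment has finite support. *)
Definition expectY p (V : 'rV[int]_n.+1 -> R[i]) y : R[i] :=
  \sum_(v <- jumps p) (jump_prob p v)%:C * V (stepY y v).

Definition harmonicY p (O : pred 'rV[int]_n.+1) (V : 'rV[int]_n.+1 -> R[i]) :
  Prop := forall y, y \in O -> V y = expectY p V y.

Implicit Types (beta : R[i]) (alpha : {ffun 'I_n -> R[i]}).

Definition bracket beta alpha z : R[i] :=
  beta ^ (coord1 z - \sum_l coord z l) * \prod_l alpha l ^ coord z l.

Definition nonzero_point beta alpha : Prop :=
  beta != 0 /\ forall l, alpha l != 0.

Definition in_H p beta alpha : Prop :=
  nonzero_point beta alpha /\
  \sum_(v <- jumps p) (jump_prob p v)%:C * bracket beta alpha v = 1.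

Definition in_Hl p l beta alpha : Prop :=
  nonzero_point beta alpha /\
  (mu p (nplus (label l)))%:C
  + \sum_(v <- jumps p | coord v l != -1)
      (jump_prob p v)%:C * bracket beta alpha v = 1.

Definition Ccoef p l beta alpha : R[i] :=
  (mu p (nplus (label l)))%:C
  - \sum_(v <- jumps p | coord v l == -1)
      (jump_prob p v)%:C * bracket beta alpha v.

Definition set_one alpha l : {ffun 'I_n -> R[i]} :=
  [ffun k => if k == l then 1 else alpha k].

Definition conjugate p l beta alpha1 alpha2 : Prop :=
  let num := \sum_(v <- jumps p | coord v l == -1)
    (jump_prob p v)%:C * bracket beta (set_one alpha1 l) v in
  let den := \sum_(v <- jumps p | coord v l == 1)
    (jump_prob p v)%:C * bracket beta (set_one alpha1 l) v in
  [/\ in_H p beta alpha1 /\ in_H p beta alpha2,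
      alpha1 != alpha2,
      forall k, k != l -> alpha1 k = alpha2 k,
      den != 0
    & alpha2 l = (alpha1 l)^-1 * (num / den)].

End Network.

(* None encodes G(i,j) = 0.  The values edge_label i i carry no meaning: the
   set G(j,j) is loops j. *)
Record labeled_graph (VG : finType) (n : nat) := LabeledGraph {
  edge_label : VG -> VG -> option 'I_n;
  loops : VG -> {set 'I_n};
  edge_label_sym :
    forall i j, i != j -> edge_label i j = edge_label j i
}.

Definition edge_complete (VG : finType) n (G : labeled_graph VG n) : Prop :=
  forall (j : VG) (l : 'I_n),
    (#|[set i | (i != j) && (edge_label G j i == Some l)]|
     + (l \in loops G j) = 1)%N.

(* In the constraint on c i / c j, division by zero yields 0; since c i / c j
   is nonzero, the constraint entails that both coefficients are nonzero. *)
Definition harmonic_system_solution (R : realType) n (p : 'M[R]_n.+2)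
    (VG : finType) (G : labeled_graph VG n)
    (beta : R[i]) (alpha : VG -> {ffun 'I_n -> R[i]}) (c : VG -> R[i]) : Prop :=
  [/\ forall j, in_H p beta (alpha j) /\ c j != 0,
      forall i j, i != j -> alpha i != alpha j,
      forall i j l, i != j -> edge_label G i j = Some l ->
        conjugate p l beta (alpha i) (alpha j),
      forall i j l, i != j -> edge_label G i j = Some l ->
        c i / c j = - (Ccoef p l beta (alpha j) / Ccoef p l beta (alpha i))
    & forall j l, l \in loops G j -> in_Hl p l beta (alpha j)].

Definition h_G (R : realType) n (VG : finType)
    (beta : R[i]) (alpha : VG -> {ffun 'I_n -> R[i]}) (c : VG -> R[i])
    (z : 'rV[int]_n.+1) : R[i] :=
  \sum_j c j * bracket beta (alpha j) z.

(* Main.v *)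
From Pilot Require Import Defs.
From mathcomp Require Import all_boot all_order all_algebra.
From mathcomp Require Import reals complex.
From mathcomp Require Import zify.

Set Implicit Arguments.
Unset Strict Implicit.
Unset Printing Implicit Defensive.

Import Order.TTheory GRing.Theory Num.Theory.
(* [coord] is the coordinate of a state, not that of a vector in a basis. *)
Import Pilot.Defs.

Local Open Scope ring_scope.
Local Open Scope complex_scope.

(** Compare [Y] with the unconstrained walk of the same increments.  From a
    state [y] the two differ only in the suppressed jumps: those with
    [v(l) = -1] for some [l] with [y(l) = 0].  An increment is a single
    transition from one node to another, and only the node of departure can
    give it a coordinate [-1] in a label.  So a suppressed jump has exactly one
    such [l], and the generator of [Y] is the free generator minus one
    correction for each face [y(l) = 0] containing [y] ([expectY_drift]).

    On an exponential [(beta, alpha)] in [H] the free generator vanishes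
    ([free_drift_bracket]) and the correction of the face [l] is multiplication
    by [- C(l, beta, alpha)] ([face_drift_bracket]).  So [h_G] is harmonic as
    soon as [sum_j c_j C(l, beta, alpha_j) [(beta, alpha_j), y]] vanishes
    whenever [y(l) = 0].

    This sum vanishes by cancellation in pairs ([face_cancellation]).
    Edge-completeness says that following the [l]-edge is an involution of the
    vertices.  At a loop, [H] and [H_l] together force [C = 0].  Along a proper
    edge, [alpha_i] and [alpha_j] differ only in the entry [l], which a state
    with [y(l) = 0] does not see, so the two exponentials take the same value
    at [y], and the condition on [c_i / c_j] says that their coefficients are
    opposite. *)

(** * Increments of the walk *)

Section Increments.
Variable n : nat.
Implicit Types (y v : 'rV[int]_n.+1) (l : 'I_n) (j k : 'I_n.+2).

Lemma coordD y v l : coord (y + v) l = coord y l + coord v l.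
Proof. by rewrite /coord mxE. Qed.

Lemma coord1D y v : coord1 (y + v) = coord1 y + coord1 v.
Proof. by rewrite /coord1 mxE. Qed.

Lemma coord_increment j k l :
  coord (increment j k) l
  = (nplus (label l) == k)%:R - (nplus (label l) == j)%:R.
Proof. by rewrite /coord /increment /flip !mxE. Qed.

Lemma coord_increment_ge j k l : -1 <= coord (increment j k) l.
Proof. by rewrite coord_increment; do 2 case: eqP. Qed.

Lemma coord_increment_eqN1 j k l :
  (coord (increment j k) l == -1) = (j == nplus (label l)) && (j != k).
Proof.
rewrite coord_increment [j == _]eq_sym.
have [->|_] := eqVneq (nplus (label l)) j; first by case: (eqVneq j k).
by case: (_ == k).
Qed.

Lemma coord_increment_eqN1_inj j k l l' :
  coord (increment j k) l == -1 -> coord (increment j k) l' == -1 -> l = l'.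
Proof.
rewrite !coord_increment_eqN1 => /andP[/eqP-> _] /andP[/eqP E _].
exact: (lift_inj (lift_inj E)).
Qed.

End Increments.

(** * The generator, free and with reflection *)

Section Generator.
Variables (R : realType) (n : nat) (p : 'M[R]_n.+2).
Hypothesis hp : routing_matrix p.
Implicit Types (y v : 'rV[int]_n.+1) (l : 'I_n).

Lemma jumpsP v :
  reflect (exists j k, 0 < p j k /\ v = increment j k) (v \in jumps p).
Proof.
rewrite mem_undup; apply: (iffP mapP) => [[[j k]]|[j [k [pjk ->]]]].
  by rewrite mem_filter /= => /andP[pjk _] ->; exists j, k.
by exists (j, k); rewrite // mem_filter /= pjk mem_enum.
Qed.

(** This undoes the grouping of transitions by increment, whatever the
    collisions between increments. *)
Lemma sum_jump_prob (P : pred 'rV[int]_n.+1) :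
  \sum_(v <- jumps p | P v) jump_prob p v
  = \sum_j \sum_(k | P (increment j k)) p j k.
Proof.
have [p0 _ _] := hp.
rewrite (pair_big_dep predT (fun j k => P (increment j k)) (fun j k => p j k)).
rewrite /jump_prob (exchange_big_dep (fun jk => P (increment jk.1 jk.2))) /=;
  last by move=> v jk Pv /eqP->.
apply: eq_bigr => -[j k] /= Pjk.
have -> : \sum_(v <- jumps p | P v && (increment j k == v)) p j k
          = \sum_(v <- jumps p | v == increment j k) p j k.
  apply: eq_bigl => v; rewrite eq_sym.
  by case: eqP => [->|]; rewrite ?Pjk ?andbF.
rewrite big_const_seq iter_addr_0 (count_uniq_mem _ (undup_uniq _)).
case: (boolP (_ \in _)) => [//|/jumpsP notin]; rewrite mulr0n.
have := p0 j k; rewrite le_eqVlt => /predU1P[//|pjk].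
by case: notin; exists j, k.
Qed.

Lemma sum_jump_prob1 : \sum_(v <- jumps p) jump_prob p v = 1.
Proof. by have [_ _ <-] := hp; rewrite sum_jump_prob. Qed.

(** The jumps that lower the coordinate [l] are the departures from one node,
    so their total rate is the service rate there. *)
Lemma sum_jump_prob_departure l :
  \sum_(v <- jumps p | coord v l == -1) jump_prob p v = mu p (nplus (label l)).
Proof.
have [_ pd _] := hp; set L := nplus (label l).
rewrite sum_jump_prob (bigD1 L) //= [X in _ + X]big1 ?addr0 => [|j /negPf jL].
  rewrite /mu [RHS](bigID (fun k => L != k)) /= [X in _ + X]big1 ?addr0.
    by apply: eq_bigl => k; rewrite coord_increment_eqN1 eqxx.
  by move=> k /negPn/eqP <-.
by rewrite big_pred0 // => k; rewrite coord_increment_eqN1 jL.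
Qed.

(** The inner sum has one term when the jump is suppressed, and none
    otherwise. *)
Lemma stepY_increment (V : 'rV[int]_n.+1 -> R[i]) y v :
  y \in @OmegaY n -> v \in jumps p ->
  V (stepY y v) - V y
  = (V (y + v) - V y)
    - \sum_(l | (coord y l == 0) && (coord v l == -1)) (V (y + v) - V y).
Proof.
move=> /forallP yO /jumpsP[j [k [_ ->]]]; set v0 := increment j k.
rewrite /stepY; case: ifPn => [/forallP yvO|].
  rewrite big_pred0 ?subr0 // => l.
  by have := yvO l; rewrite coordD; lia.
rewrite negb_forall => /existsP[l0 yv_neg].
have y0 := yO l0; have v_ge := coord_increment_ge j k l0.
rewrite coordD -/v0 in yv_neg v_ge *.
have [yl0 vl0] : coord y l0 = 0 /\ coord v0 l0 = -1 by lia.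
rewrite (big_pred1 l0) ?subrr // => l; apply/andP/eqP => [[_ vl]|->].
  by apply: coord_increment_eqN1_inj vl _; rewrite -/v0 vl0.
by rewrite yl0 vl0.
Qed.

Definition free_drift (V : 'rV[int]_n.+1 -> R[i]) y : R[i] :=
  \sum_(v <- jumps p) (jump_prob p v)%:C * (V (y + v) - V y).

Definition face_drift l (V : 'rV[int]_n.+1 -> R[i]) y : R[i] :=
  \sum_(v <- jumps p | coord v l == -1)
    (jump_prob p v)%:C * (V (y + v) - V y).

Lemma expectY_drift (V : 'rV[int]_n.+1 -> R[i]) y : y \in @OmegaY n ->
  expectY p V y - V y
  = free_drift V y - \sum_(l | coord y l == 0) face_drift l V y.
Proof.
move=> yO.
have -> : expectY p V y - V y
    = \sum_(v <- jumps p) (jump_prob p v)%:C * (V (stepY y v) - V y).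
  rewrite (eq_bigr _ (fun v _ => mulrBr _ _ _)) sumrB; congr (_ - _).
  by rewrite -mulr_suml -rmorph_sum /= sum_jump_prob1 mul1r.
rewrite (exchange_big_dep predT) //= -sumrB.
rewrite big_seq [in RHS]big_seq; apply: eq_bigr => v vJ.
by rewrite stepY_increment // mulrBr mulr_sumr.
Qed.

(** * Exponentials *)

Implicit Types (beta : R[i]) (alpha : {ffun 'I_n -> R[i]}).

Lemma bracketD beta alpha y v : nonzero_point beta alpha ->
  bracket beta alpha (y + v) = bracket beta alpha y * bracket beta alpha v.
Proof.
move=> [b0 a0]; rewrite /bracket mulrACA -expfzDr // -big_split /=.
congr (_ ^ _ * _); last by apply: eq_bigr => l _; rewrite coordD expfzDr.
rewrite coord1D (eq_bigr _ (fun l _ => coordD y v l)) big_split /=.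
by rewrite opprD addrACA.
Qed.

Lemma bracket_face beta alpha alpha' l y :
  (forall k, k != l -> alpha k = alpha' k) -> coord y l = 0 ->
  bracket beta alpha y = bracket beta alpha' y.
Proof.
move=> agree yl; congr (_ * _); apply: eq_bigr => k _.
by have [->|/agree->//] := eqVneq k l; rewrite yl.
Qed.

Lemma free_drift_bracket beta alpha y : in_H p beta alpha ->
  free_drift (bracket beta alpha) y = 0.
Proof.
move=> [nz H1].
rewrite /free_drift.
under eq_bigr => v _ do
  rewrite bracketD // -{2}[bracket _ _ y]mulr1 -mulrBr mulrCA mulrBr mulr1.
by rewrite -mulr_sumr sumrB H1 -rmorph_sum /= sum_jump_prob1 subrr mulr0.
Qed.

Lemma face_drift_bracket l beta alpha y : nonzero_point beta alpha ->
  face_drift l (bracket beta alpha) y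
  = - (Ccoef p l beta alpha * bracket beta alpha y).
Proof.
move=> nz; rewrite /face_drift.
under eq_bigr => v _ do
  rewrite bracketD // -{2}[bracket _ _ y]mulr1 -mulrBr mulrCA mulrBr mulr1.
rewrite -mulr_sumr sumrB -rmorph_sum /= sum_jump_prob_departure.
by rewrite mulrC -mulNr opprB.
Qed.

Lemma Ccoef_loop l beta alpha :
  in_H p beta alpha -> in_Hl p l beta alpha -> Ccoef p l beta alpha = 0.
Proof.
move=> [_ H1] [_]; rewrite -{}H1 [RHS](bigID (fun v => coord v l == -1)) /=.
by move=> /addIr E; rewrite /Ccoef E subrr.
Qed.

Lemma drift_sum (VG : finType) (c : VG -> R[i])
    (f : VG -> 'rV[int]_n.+1 -> R[i]) (P : pred 'rV[int]_n.+1) y :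
  \sum_(v <- jumps p | P v) (jump_prob p v)%:C
    * (\sum_j c j * f j (y + v) - \sum_j c j * f j y)
  = \sum_j c j * \sum_(v <- jumps p | P v)
      (jump_prob p v)%:C * (f j (y + v) - f j y).
Proof.
under [RHS]eq_bigr => j _ do rewrite mulr_sumr.
rewrite exchange_big /=; apply: eq_bigr => v _.
rewrite -sumrB mulr_sumr; apply: eq_bigr => j _.
by rewrite -mulrBr mulrCA.
Qed.

Lemma free_drift_sum (VG : finType) (c : VG -> R[i])
    (f : VG -> 'rV[int]_n.+1 -> R[i]) y :
  free_drift (fun z => \sum_j c j * f j z) y = \sum_j c j * free_drift (f j) y.
Proof. exact: drift_sum. Qed.

Lemma face_drift_sum l (VG : finType) (c : VG -> R[i])
    (f : VG -> 'rV[int]_n.+1 -> R[i]) y :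
  face_drift l (fun z => \sum_j c j * f j z) y
  = \sum_j c j * face_drift l (f j) y.
Proof. exact: drift_sum. Qed.

End Generator.

(** * Matchings of an edge-complete graph *)

Lemma sum_sign_reversing (F : numDomainType) (T : finType) (s : T -> T)
    (f : T -> F) :
  involutive s -> (forall x, f (s x) = - f x) -> \sum_x f x = 0.
Proof.
move=> sK fs; have /eqP : \sum_x f x = - \sum_x f x.
  rewrite {1}(reindex_inj (inv_inj sK)) -sumrN.
  by apply: eq_bigr => x _; rewrite fs.
by rewrite -subr_eq0 opprK -mulr2n mulrn_eq0 /= => /eqP.
Qed.

Section Matching.
Variables (VG : finType) (n : nat) (G : labeled_graph VG n).
Hypothesis hG : edge_complete G.
Implicit Types (i j : VG) (l : 'I_n).

(** The other end of the [l]-edge at [j], which is [j] itself for a loop. *)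
Definition partner l j : VG :=
  odflt j [pick i | (i != j) && (edge_label G j i == Some l)].

Variant partner_spec l j : VG -> Prop :=
  | PartnerLoop of l \in loops G j : partner_spec l j j
  | PartnerEdge i of i != j & edge_label G j i = Some l : partner_spec l j i.

Lemma partnerP l j : partner_spec l j (partner l j).
Proof.
rewrite /partner; case: pickP => [i /andP[ij /eqP Gji]|none].
  exact: PartnerEdge.
apply: PartnerLoop; have := hG j l.
by rewrite eq_card0 => [|i]; rewrite ?inE ?none //; case: (l \in _).
Qed.

Lemma partner_edge l i j :
  i != j -> edge_label G j i = Some l -> partner l j = i.
Proof.
move=> ij Gji; have := hG j l.
set A := [set _ | _] => cardA.
have iA : i \in A by rewrite inE ij Gji eqxx.
have /cards1P[a Aa] : #|A| == 1%N.
  by have : (0 < #|A|)%N by [apply/card_gt0P; exists i]; lia.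
rewrite /partner; case: pickP => [i' i'P|/(_ i)]; last by rewrite ij Gji eqxx.
have : i' \in A by rewrite inE.
by move: iA; rewrite Aa !inE => /eqP-> /eqP->.
Qed.

Lemma partner_loop l j : l \in loops G j -> partner l j = j.
Proof.
move=> lj; have := hG j l; rewrite lj.
rewrite /partner; case: pickP => // i Pi.
set A := [set _ | _].
by have : (0 < #|A|)%N by [apply/card_gt0P; exists i; rewrite inE]; lia.
Qed.

Lemma partnerK l : involutive (partner l).
Proof.
move=> j; case: (partnerP l j) => [/partner_loop//|i ij Gji].
by apply: partner_edge; rewrite 1?eq_sym // edge_label_sym.
Qed.

End Matching.

(** * Cancellation on the faces *)

(** The contributions of a vertex and of its [l]-partner are opposite. *)
Lemma face_cancellation (R : realType) (n : nat) (p : 'M[R]_n.+2)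
    (VG : finType) (G : labeled_graph VG n) (beta : R[i])
    (alpha : VG -> {ffun 'I_n -> R[i]}) (c : VG -> R[i]) l y :
  edge_complete G -> harmonic_system_solution p G beta alpha c ->
  coord y l = 0 ->
  \sum_j c j * (Ccoef p l beta (alpha j) * bracket beta (alpha j) y) = 0.
Proof.
move=> hG [hH _ hconj hc hloop] yl.
apply: (sum_sign_reversing (partnerK hG l)) => j.
case: (partnerP hG l j) => [lj|i ij Gji].
  by rewrite Ccoef_loop ?mul0r ?mulr0 ?oppr0 //; [case: (hH j)|apply: hloop].
have ji : j != i by rewrite eq_sym.
have [_ _ agree _ _] := hconj _ _ _ ji Gji.
rewrite (bracket_face _ agree yl) [LHS]mulrA [in RHS]mulrA -mulNr; congr (_ * _).
have [_ ci] := hH i; have [_ cj] := hH j.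
have cij := hc _ _ _ ji Gji.
(* With x / 0 = 0, the ratio condition would give c j = 0 if C_j were 0. *)
have Cj : Ccoef p l beta (alpha j) != 0.
  apply: contraTneq cj => Cj0; move/eqP: cij.
  by rewrite Cj0 invr0 mulr0 oppr0 mulf_eq0 invr_eq0 (negPf ci) orbF => ->.
rewrite -[c j](divfK ci) {}cij !mulNr opprK.
by rewrite mulrAC (divfK Cj) mulrC.
Qed.

Theorem proposition5p2 (R : realType) (n : nat) (hd : (2 <= n.+1)%N)
  (p : 'M[R]_n.+2) (hp : routing_matrix p) (hirr : irreducible_matrix p)
  (hstab : stable p)
  (VG : finType) (G : labeled_graph VG n) (hG : edge_complete G)
  (beta : R[i]) (alpha : VG -> {ffun 'I_n -> R[i]}) (c : VG -> R[i])
  (hsol : harmonic_system_solution p G beta alpha c) :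
  harmonicY p (@OmegaY n) (h_G beta alpha c).
Proof.
move=> y yO; apply/esym/eqP; rewrite -subr_eq0 (expectY_drift hp) //.
have [hH _ _ _ _] := hsol.
rewrite [free_drift _ _ _]free_drift_sum [X in X - _]big1; last first.
  by move=> j _; have [Hj _] := hH j; rewrite (free_drift_bracket hp) ?mulr0.
rewrite sub0r big1 ?oppr0 // => l /eqP yl.
rewrite [face_drift _ _ _ _]face_drift_sum.
rewrite -[RHS]oppr0 -[X in - X](face_cancellation hG hsol yl) -sumrN.
apply: eq_bigr => j _; have [[nz _] _] := hH j.
by rewrite (face_drift_bracket hp l y nz) mulrN.
Qed.
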